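(* Let $q\ge 0$ be an integer such that $p=4q+3$ is prime, and let $a$ be a positive integer whose residue class modulo $p$ is a quadratic non-residue of $\mathbb{Z}_p$. Then \[dac\big(\overrightarrow{C}_{8q^2+2(a+4)q+a+3}(1,a)\big)\geq 4q+3.\] Moreover, for $a=3$ (when $3$ is a quadratic non-residue of $\mathbb{Z}_{4q+3}$) equality holds: $dac(\overrightarrow{C}_{8q^2+14q+6}(1,3))=4q+3$.
   Context: For an integer $n$ and a set $J\subseteq\{1,\dots,n-1\}$, the circulant digraph $\overrightarrow{C}_n(J)$ has vertex set $\mathbb{Z}_n$ and arc set $\{(i,j): j-i\equiv s \pmod n \text{ for some } s\in J\}$. An acyclic vertex coloring of a digraph $D$ is one with no monochromatic directed cycle. A complete $k$-vertex-coloring of $D$ uses exactly $k$ colors and, for every ordered pair $(i,j)$ of distinct colors, there is an arc $(u,v)$ with $u$ colored $i$ and $v$ colored $j$. The diachromatic number $dac(D)$ is the largest $k$ for which $D$ has a complete acyclic $k$-vertex-coloring. A quadratic non-residue of $\mathbb{Z}_p$ is a nonzero element that is not a square. *)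

(* Defs.v *)
From mathcomp Require Import all_boot all_order all_algebra.

Set Implicit Arguments.
Unset Strict Implicit.
Unset Printing Implicit Defensive.

(* Circulant digraph on Z_n, represented by {0, ..., n-1}.  It is intended for
   connection sets J contained in {1, ..., n-1}; other integers are read
   modulo n. *)
Definition circulant (n : nat) (J : seq nat) : rel 'I_n :=
  fun i j => has (fun s => j == i + s %[mod n]) J.

(* Simple directed cycles have at most #|T| vertices, so the bounded
   quantification covers all of them (see acyclic_coloringP below); cycles of
   length 2, i.e. pairs of opposite arcs, are included. *)
Definition acyclic_coloring (T : finType) (e : rel T) (k : nat)
    (f : {ffun T -> 'I_k}) : bool :=
  [forall m : 'I_#|T|, forall c : m.+1.-tuple T,
     ucycleb e c ==> ~~ constant [seq f v | v <- c]].

Definition complete_coloring (T : finType) (e : rel T) (k : nat)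
    (f : {ffun T -> 'I_k}) : bool :=
  [forall i : 'I_k, exists v, f v == i] &&
  [forall i : 'I_k, forall j : 'I_k,
     (i != j) ==> [exists u, exists v, [&& e u v, f u == i & f v == j]]].

Definition complete_acyclic_colorable (T : finType) (e : rel T) (k : nat) :
    bool :=
  [exists f : {ffun T -> 'I_k}, complete_coloring e f && acyclic_coloring e f].

(* A coloring using all of its k colors has k <= #|T|, so bounding k loses
   nothing (see dac_max and dac_attained below).  The value is 0 when no such
   coloring exists, which for nonempty T happens only if e has a loop. *)
Definition dac (T : finType) (e : rel T) : nat :=
  \max_(k < #|T|.+1 | complete_acyclic_colorable e k) k.

Definition quadratic_nonresidue (p : nat) (x : 'F_p) : bool :=
  (x != 0%R) && ~~ [exists y : 'F_p, x == (y ^+ 2)%R].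

Lemma acyclic_coloringP (T : finType) (e : rel T) (k : nat)
    (f : {ffun T -> 'I_k}) :
  reflect (forall c : seq T, c != [::] -> ucycle e c ->
             ~~ constant [seq f v | v <- c])
          (acyclic_coloring e f).
Proof.
apply: (iffP forallP) => [H c c0 uc | H m].
  have sc : (size c).-1 < #|T|.
    have /card_uniqP <- : uniq c by case/andP: uc.
    have : 0 < #|c|.
      by case: c c0 {uc} => // x c _; apply/card_gt0P; exists x; rewrite inE eqxx.
    by move=> c_gt0; rewrite prednK // max_card.
  have /eqP zc : size c == (Ordinal sc).+1 by rewrite /= prednK // lt0n size_eq0.
  by have /forallP/(_ (Tuple (introT eqP zc)))/implyP := H (Ordinal sc); apply.
apply/forallP => c; apply/implyP => uc; apply: H => //.
by rewrite -size_eq0 size_tuple.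
Qed.

Lemma complete_acyclic_colorable_card (T : finType) (e : rel T) (k : nat) :
  complete_acyclic_colorable e k -> k <= #|T|.
Proof.
case/existsP=> f /andP[/andP[/forallP fS _] _].
rewrite -[k]card_ord -(_ : #|codom f| = #|'I_k|) ?leq_image_card //.
apply: eq_card => i; rewrite !inE.
by have /existsP[v /eqP <-] := fS i; rewrite codom_f.
Qed.

Lemma dac_max (T : finType) (e : rel T) (k : nat) :
  complete_acyclic_colorable e k -> k <= dac e.
Proof.
move=> ek; have lek := complete_acyclic_colorable_card ek.
by rewrite -[k]/(val (Ordinal (lek : k < #|T|.+1))) /dac; apply: leq_bigmax_cond.
Qed.

Lemma dac_attained (T : finType) (e : rel T) :
  0 < dac e -> complete_acyclic_colorable e (dac e).
Proof.
rewrite /dac; elim/big_ind: _ => // m n Hm Hn.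
by rewrite /maxn; case: ifP.
Qed.

(* Main.v *)
(** Write p = 2m + 1 and L = p + a - 1, so that n = mL + 1.  For the lower
    bound, cut the path 0, 1, ..., n - 1 into m blocks of L + 1 vertices, with
    consecutive blocks sharing an endpoint, and colour it by elements of F_p
    so that the colour increases by (k + 1)^2 at each step inside the k-th
    block (k = 0, ..., m - 1).  The k-th block then realises every pair of
    colours whose difference is (k + 1)^2 or a(k + 1)^2.  These 2m elements are
    distinct, so they are all the nonzero elements of F_p.  A monochromatic arc
    has to cross from one block to the next, and it decreases the offset inside
    the block, hence there is no monochromatic cycle.

    For the upper bound, a complete k-colouring of a digraph of outdegree at
    most 2 has classes with at least (k - 1) / 2 vertices.  If k >= 4q + 4 this
    rounds up to 2q + 2, and (4q + 4)(2q + 2) exceeds n. *)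
Require Import Defs.
From mathcomp Require Import all_boot all_order all_algebra.
From mathcomp Require Import zify.

(** * Bounds on the diachromatic number of a general digraph *)

(** Going once round a monochromatic cycle would give [phi x < phi x]. *)
Lemma acyclic_coloring_potential {T : finType} {e : rel T} {k : nat}
    {f : {ffun T -> 'I_k}} (phi : T -> nat) :
  (forall u v, e u v -> f u = f v -> phi v < phi u) -> acyclic_coloring e f.
Proof.
move=> phi_lt; apply/acyclic_coloringP => -[//|x s] _ /andP[cyc _].
apply/negP => /= /allP fx.
have fE y : y \in x :: s -> f y = f x.
  by rewrite inE => /predU1P[-> //|ys]; apply/eqP/fx/map_f.
pose r := [rel u v | phi v < phi u].
have r_trans : transitive r by move=> v u w /= uv vw; exact: ltn_trans vw uv.
have : cycle r (x :: s).
  apply: (sub_in_cycle (P := mem (x :: s))) cyc; last by apply/allP.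
  by move=> u v us vs euv; apply: phi_lt; rewrite ?fE.
move=> /(order_path_min r_trans)/allP/(_ x).
by rewrite mem_rcons mem_head /= ltnn => /(_ isT).
Qed.

(** Colours may come from any finite type, such as ['F_p] below; [enum_rank] turns them into
    ordinals. *)
Lemma dac_ge {T C : finType} (e : rel T) (f : T -> C) (phi : T -> nat) :
  (forall c, exists v, f v = c) ->
  (forall c d, c != d -> exists u v, [/\ e u v, f u = c & f v = d]) ->
  (forall u v, e u v -> f u = f v -> phi v < phi u) ->
  #|C| <= dac e.
Proof.
move=> f_surj f_compl phi_lt; apply: dac_max.
apply/existsP; exists [ffun v => enum_rank (f v)].
rewrite (acyclic_coloring_potential phi) ?andbT; last first.
  by move=> u v euv; rewrite !ffunE => /enum_rank_inj; apply: phi_lt.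
apply/andP; split.
  apply/forallP => i; have [v fv] := f_surj (enum_val i).
  by apply/existsP; exists v; rewrite ffunE fv enum_valK.
apply/forallP => i; apply/forallP => j; apply/implyP => neq_ij.
have [|u [v [euv fu fv]]] := f_compl (enum_val i) (enum_val j).
  by rewrite (inj_eq enum_val_inj).
apply/existsP; exists u; apply/existsP; exists v.
by rewrite !ffunE fu fv !enum_valK euv !eqxx.
Qed.

(** The out-neighbours of the class of [i] must carry all the other [k.-1] colours. *)
Lemma complete_coloring_card {T : finType} {e : rel T} {k d : nat}
    {f : {ffun T -> 'I_k}} :
  (forall u, #|[set v | e u v]| <= d) -> complete_coloring e f ->
  forall i, k.-1 <= d * #|[set v | f v == i]|.
Proof.
move=> e_deg /andP[_ /forallP f_compl] i.
have -> : k.-1 = #|[set~ i]| by rewrite cardsC1 card_ord.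
have sub : [set~ i] \subset
    \bigcup_(u in [set v | f v == i]) (f @: [set v | e u v]).
  apply/subsetP => j; rewrite !inE => neq_ji.
  have /forallP/(_ j) := f_compl i; rewrite eq_sym neq_ji /=.
  case/existsP=> u /existsP[v /and3P[euv fu /eqP <-]].
  by apply/bigcupP; exists u; rewrite ?inE //; apply: imset_f; rewrite inE.
apply: leq_trans (subset_leq_card sub) _.
rewrite mulnC -sum_nat_const.
elim/big_rec2: _ => [|u s A _ le_s]; first by rewrite cards0.
apply: leq_trans (leq_card_setU _ _) (leq_add _ le_s).
exact: leq_trans (leq_imset_card _ _) (e_deg u).
Qed.

Lemma circulant_outdegree (n : nat) (J : seq nat) (u : 'I_n) :
  #|[set v | circulant J u v]| <= size J.
Proof.
have n_gt0 : 0 < n by apply: leq_ltn_trans (ltn_ord u).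
pose g s := Ordinal (ltn_pmod (u + s) n_gt0).
rewrite -(size_map g); apply: leq_trans (card_size _).
apply/subset_leq_card/subsetP => v; rewrite inE => /hasP[s Js /eqP uv].
apply/mapP; exists s => //; apply: val_inj => /=.
by rewrite -uv modn_small.
Qed.

(** * The lower bound, with colours in F_p *)

Section Lower.
Local Open Scope ring_scope.
Import GRing.Theory.

Lemma natr_Fp_neq0 (p k : nat) : prime p -> (0 < k < p)%N -> k%:R != 0 :> 'F_p.
Proof.
move=> p_pr /andP[k_gt0 k_lt].
by rewrite -(dvdn_pcharf (pchar_Fp p_pr)) gtnNdvd.
Qed.

Lemma Fp_square_or_nonresidue_square (m : nat) (a d : 'F_(2 * m).+1) :
  prime (2 * m).+1 -> quadratic_nonresidue a -> d != 0 ->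
  exists2 k, (k < m)%N & d = k.+1%:R ^+ 2 \/ d = a * k.+1%:R ^+ 2.
Proof.
set p := (2 * m).+1 in a d *; move=> p_pr /andP[a_neq0 /existsPn a_nsq] d_neq0.
have S_neq0 k : (k < m)%N -> k.+1%:R != 0 :> 'F_p.
  by move=> k_lt; apply: natr_Fp_neq0 => //; rewrite /p; lia.
(* [None] stands for 0, so the source of [F] has 2m + 1 = p elements and injectivity yields
   surjectivity. *)
pose F (x : option (bool * 'I_m)) : 'F_p :=
  if x is Some (b, k) then (if b then a else 1) * k.+1%:R ^+ 2 else 0.
have c_neq0 (b : bool) : (if b then a else 1) != 0.
  by case: b; rewrite ?oner_neq0.
have F_neq0 b k : F (Some (b, k)) != 0.
  by rewrite mulf_neq0 // expf_neq0 // S_neq0.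
have nsq (j k : 'I_m) : a * k.+1%:R ^+ 2 != j.+1%:R ^+ 2.
  apply: contra (a_nsq (j.+1%:R / k.+1%:R)) => /eqP akj.
  by rewrite expr_div_n -akj mulfK // expf_neq0 // S_neq0.
have F_inj : injective F.
  move=> [[b j]|] [[c k]|] // /eqP; last 2 first.
  - by rewrite (negPf (F_neq0 b j)).
  - by rewrite eq_sym (negPf (F_neq0 c k)).
  have [<-{c}|] := eqVneq b c; last first.
    case: b c => -[] //= _; rewrite mul1r ?(negPf (nsq _ _)) //.
    by rewrite eq_sym (negPf (nsq _ _)).
  (* Equal squares force j + 1 = ±(k + 1) in F_p. The sum, and the difference unless j = k, is
     nonzero and less than p in absolute value, which leaves j = k. *)
  rewrite /F (inj_eq (mulfI (c_neq0 b))) eqf_sqr => /orP[|].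
    wlog le_jk : j k / (j <= k)%N.
      move=> W; case: (leqP j k) => [|/ltnW] /W // {}W; rewrite eq_sym => /W.
      by case=> ->.
    rewrite eq_sym -subr_eq0 -natrB // => /eqP kj.
    have [lt_jk|] := ltnP j k.
      have : (k.+1 - j.+1)%:R != 0 :> 'F_p.
        by apply: natr_Fp_neq0 => //; have := ltn_ord k; rewrite /p; lia.
      by rewrite kj eqxx.
    move=> le_kj; congr (Some (_, _)); apply: val_inj; apply/eqP.
    by rewrite eqn_leq le_jk.
  rewrite -addr_eq0 -natrD => /eqP kj.
  have : (j.+1 + k.+1)%:R != 0 :> 'F_p.
    apply: natr_Fp_neq0 => //.
    by have := ltn_ord k; have := ltn_ord j; rewrite /p; lia.
  by rewrite kj eqxx.
have card_le : (#|{: 'F_p}| <= #|{: option (bool * 'I_m)}|)%N.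
  by rewrite card_Fp // card_option card_prod card_bool card_ord.
have /codomP[[[b k]|] dF] := inj_card_onto F_inj card_le d.
  exists k => //; rewrite dF /F; case: (b); [by right | by left; rewrite mul1r].
by rewrite dF eqxx in d_neq0.
Qed.

(** As a prefix sum, the colour is automatically consistent at the endpoint shared by two blocks. *)
Definition block_color (F : nzRingType) (L x : nat) : F :=
  \sum_(0 <= i < x) (i %/ L).+1%:R ^+ 2.

(** The case [t = L] is included: the first vertex of the next block also closes block [k]. *)
Lemma block_colorD (F : nzRingType) (L k t : nat) : (t <= L)%N ->
  block_color F L (k * L + t) = block_color F L (k * L) + t%:R * k.+1%:R ^+ 2.
Proof.
elim: t => [|t IHt] t_lt; first by rewrite addn0 mul0r addr0.
rewrite addnS /block_color big_nat_recr //= -/(block_color _ _ _).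
rewrite IHt; last exact: ltnW.
rewrite divnMDl ?(leq_trans _ t_lt) // divn_small // addn0.
by rewrite -addrA -[t.+1]addn1 natrD mulrDl mul1r.
Qed.

Lemma dac_circulant_ge (m a : nat) : prime (2 * m).+1 -> (0 < a)%N ->
  quadratic_nonresidue (a%:R : 'F_(2 * m).+1) ->
  ((2 * m).+1 <= dac (@circulant (m * (2 * m + a)).+1 [:: 1; a]))%N.
Proof.
set p := (2 * m).+1; set L := (2 * m + a)%N; move=> p_pr a_gt0 a_nr.
have m_gt0 : (0 < m)%N by move: p_pr; rewrite /p; case: (m).
have a_neq0 : a%:R != 0 :> 'F_p by case/andP: a_nr.
have S_neq0 k : (k < m)%N -> k.+1%:R ^+ 2 != 0 :> 'F_p.
  by move=> k_lt; rewrite expf_neq0 // natr_Fp_neq0 //; rewrite /p; lia.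
pose f := block_color 'F_p L.
have block_surj k c : (k < m)%N -> exists2 t, (t < p)%N & f (k * L + t)%N = c.
  (* Solves f(kL) + t(k + 1)^2 = c for t. *)
  move=> k_lt; pose t : 'F_p := (c - f (k * L)%N) / k.+1%:R ^+ 2.
  have t_lt : (t < p)%N by rewrite -[ltnRHS](Fp_cast p_pr) ltn_ord.
  exists t => //; rewrite /f block_colorD; last first.
    by rewrite /L; move: t_lt; rewrite /p; lia.
  by rewrite natr_Zp divfK ?S_neq0 // addrC subrK.
have block_lt k t : (k < m)%N -> (t <= L)%N -> (k * L + t < (m * L).+1)%N.
  move=> k_lt t_le; rewrite ltnS; apply: leq_trans (_ : k.+1 * L <= _)%N.
    by rewrite mulSn addnC leq_add2r.
  by rewrite leq_mul2r k_lt orbT.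
rewrite -[leqLHS](card_Fp p_pr).
(* The last vertex closes the last block, so its offset is [L] and not [0]. *)
apply: (dac_ge _ (fun x : 'I_(m * L).+1 => f x)
  (fun x => if x == m * L :> nat then L else x %% L)%N).
- move=> c; have [t t_lt <-] := block_surj 0%N c m_gt0.
  have t_le : (t <= L)%N by rewrite /L; move: t_lt; rewrite /p; lia.
  by exists (Ordinal (block_lt 0%N t m_gt0 t_le)).
- move=> c d neq_cd.
  have [|k k_lt dc] := Fp_square_or_nonresidue_square m a%:R (d - c) p_pr a_nr.
    by rewrite subr_eq0 eq_sym.
  have [t t_lt fc] := block_surj k c k_lt.
  have [s s_J sE] : exists2 s, s \in [:: 1; a]%N & d - c = s%:R * k.+1%:R ^+ 2.
    case: dc => dc; [exists 1%N | exists a]; rewrite ?inE ?eqxx ?orbT //.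
    by rewrite mul1r.
  (* The length L = 2m + a is just enough, since t <= 2m and s <= a. *)
  have ts_le : (t + s <= L)%N.
    by move: s_J t_lt; rewrite !inE /L /p => /orP[] /eqP ->; lia.
  have t_le : (t <= L)%N by apply: leq_trans ts_le; apply: leq_addr.
  exists (Ordinal (block_lt k t k_lt t_le)).
  exists (Ordinal (block_lt k _ k_lt ts_le)).
  split; [by apply/hasP; exists s; rewrite //= addnA | by [] |].
  rewrite /= /f block_colorD // natrD mulrDl addrA -block_colorD // -/f fc.
  by rewrite -sE addrC subrK.
(* An arc inside one block changes the colour by s(k + 1)^2, which is nonzero. *)
have step_neq k t s : (k < m)%N -> (t + s <= L)%N -> s%:R != 0 :> 'F_p ->
    f (k * L + t)%N != f (k * L + (t + s))%N.
  move=> k_lt ts_le s_neq0; have t_le := leq_trans (leq_addr s t) ts_le.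
  rewrite /f !block_colorD // natrD mulrDl addrA -subr_eq0.
  by rewrite opprD addrA addrN add0r oppr_eq0 mulf_neq0 ?S_neq0.
move=> u v uv fuv; have L_gt0 : (0 < L)%N by rewrite /L; lia.
have [uE|u_neq] := eqVneq (u : nat) (m * L)%N.
  (* The last vertex has potential L, above every residue mod L, so only a loop at it has to be
     excluded. *)
  have [vE|_] := eqVneq (v : nat) (m * L)%N; last exact: ltn_pmod.
  move: uv => /hasP[s]; rewrite vE uE -[X in X == _ %[mod _]]addn0 eqn_modDl.
  rewrite mod0n !inE.
  by case/orP=> /eqP ->; rewrite modn_small // /L; nia.
have u_lt : (u < m * L)%N by have := ltn_ord u; lia.
have k_lt : (u %/ L < m)%N by rewrite ltn_divLR.
have t_lt : (u %% L < L)%N by apply: ltn_pmod.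
have uE := divn_eq u L.
move: (u %/ L)%N (u %% L)%N k_lt t_lt uE => k t k_lt t_lt uE.
have [s s_J /eqP uvs] := hasP uv.
have s_neq0 : s%:R != 0 :> 'F_p.
  by move: s_J; rewrite !inE => /orP[] /eqP ->; rewrite ?oner_neq0.
have s_le : (0 < s <= a)%N by move: s_J; rewrite !inE => /orP[] /eqP ->; lia.
have [ts_le|ts_gt] := leqP (t + s) L.
  case/eqP: (step_neq k t s k_lt ts_le s_neq0); rewrite -uE fuv; congr f.
  by have := block_lt k _ k_lt ts_le; rewrite addnA -uE => us_lt;
    rewrite -[LHS](modn_small (ltn_ord v)) uvs modn_small.
(* Since t < L, a step of length 1 stays in the block. *)
have sE : s = a.
  by move: s_J; rewrite !inE => /orP[] /eqP // s1; move: ts_gt; lia.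
subst s.
have [k1_lt|k1_ge] := ltnP k.+1 m.
  (* Entering the next block lowers the offset by L - a = 2m. *)
  have t'_lt : (t + a - L < L)%N by rewrite /L in t_lt *; lia.
  have vE : v = (k.+1 * L + (t + a - L))%N :> nat.
    have usE : (u + a = k.+1 * L + (t + a - L))%N by rewrite uE mulSn; lia.
    rewrite -[LHS](modn_small (ltn_ord v)) uvs usE modn_small //.
    by apply: block_lt => //; apply: ltnW.
  have -> : (v == (m * L)%N :> nat) = false.
    apply/negbTE; rewrite vE neq_ltn; apply/orP; left.
    apply: leq_trans (_ : k.+2 * L <= _)%N; last by rewrite leq_mul2r k1_lt orbT.
    by rewrite mulSn; lia.
  by rewrite vE modnMDl (modn_small t'_lt) /L; lia.
(* Leaving the last block wraps around modulo mL + 1, so the offset drops by L + 1 - a = p. *)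
have mE : m = k.+1 by lia.
have vE : v = (t + a - L.+1)%N :> nat.
  have usE : (u + a = (t + a - L.+1) + (m * L).+1)%N.
    by rewrite uE mE mulSn; lia.
  rewrite -[LHS](modn_small (ltn_ord v)) uvs usE modnDr modn_small //.
  by rewrite mE mulSn; move: t_lt; rewrite /L; lia.
have v_lt : (v < t)%N by rewrite vE; move: t_lt ts_gt; rewrite /L; lia.
have -> : (v == (m * L)%N :> nat) = false.
  have mLE : (m * L = L + k * L)%N by rewrite mE mulSn.
  by apply/negbTE/eqP => vmL; move: v_lt; rewrite vmL mLE; lia.
by rewrite modn_small //; lia.
Qed.
End Lower.

(** * The case p = 4q + 3 and the upper bound for a = 3 *)

Theorem theorem5 (q : nat) (p_prime : prime (4 * q + 3)) :
  (forall a : nat, 0 < a ->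
     quadratic_nonresidue (a%:R%R : 'F_(4 * q + 3)) ->
     dac (@circulant (8 * q ^ 2 + 2 * (a + 4) * q + a + 3) [:: 1; a])
       >= 4 * q + 3) /\
  (quadratic_nonresidue (3%:R%R : 'F_(4 * q + 3)) ->
   dac (@circulant (8 * q ^ 2 + 14 * q + 6) [:: 1; 3]) = 4 * q + 3).
Proof.
have lower a : 0 < a -> quadratic_nonresidue (a%:R%R : 'F_(4 * q + 3)) ->
    4 * q + 3 <=
    dac (@circulant (8 * q ^ 2 + 2 * (a + 4) * q + a + 3) [:: 1; a]).
  (* Here m = 2q + 1. *)
  have pE : 4 * q + 3 = (2 * (2 * q).+1).+1 by lia.
  have -> : 8 * q ^ 2 + 2 * (a + 4) * q + a + 3 =
      ((2 * q).+1 * (2 * (2 * q).+1 + a)).+1 by nia.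
  by move: p_prime; rewrite pE => p_pr; apply: dac_circulant_ge.
split=> // nr3; apply/eqP; rewrite eqn_leq; apply/andP; split; last first.
  have -> : 8 * q ^ 2 + 14 * q + 6 = 8 * q ^ 2 + 2 * (3 + 4) * q + 3 + 3 by lia.
  exact: lower.
set n := 8 * q ^ 2 + _ + 6; set e := circulant _.
rewrite leqNgt; apply/negP => dac_gt.
have dac_gt0 : 0 < dac e := leq_ltn_trans (leq0n _) dac_gt.
have /existsP[f /andP[f_compl _]] := dac_attained dac_gt0.
have class_ge i : 2 * q + 2 <= #|[set v | f v == i]|.
  have := complete_coloring_card (circulant_outdegree n [:: 1; 3]) f_compl i.
  by rewrite [size _]/=; move: #|_| => c; lia.
have : n = \sum_i #|[set v | f v == i]|.
  rewrite -[LHS]card_ord -sum1_card (partition_big f xpredT) //=.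
  apply: eq_bigr => i _; rewrite -sum1_card.
  by apply: eq_bigl => v; rewrite inE.
have : \sum_(i < dac e) (2 * q + 2) <= \sum_i #|[set v | f v == i]|.
  by apply: leq_sum.
rewrite sum_nat_const card_ord => le_n nE; move: le_n; rewrite -nE.
(* The product (4q + 4)(2q + 2) is n + 2q + 2. *)
move/(leq_trans (leq_mul dac_gt (leqnn _))); rewrite /n; lia.
Qed.
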